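(* For any variation parameter $v\in[0,1]$, and any policy $\pi$ (which may depend on the knowledge of $v$), $$\mathcal{R}^{\pi}(T)\ge c\,T^{(3+v)/4},$$ where $c>0$ is a universal constant.
   Context: **Nonstationary Newsvendor.** There are $T$ periods $t=1,\dots,T$. $Q$ is a fixed subset of $\mathbb{R}^+$ bounded above by $Q_{\max}$; there are known per-unit underage costs $b_t\in[0,b_{\max}]$ and overage costs $h_t\in[0,h_{\max}]$, and a known family of distributions $\mathcal{D}=\{\mathcal{D}_\mu:\mu\in[\mu_{\min},\mu_{\max}]\}$ parameterized by its mean, $\mu=\mathbb{E}[\mathcal{D}_\mu]$. It is assumed that each $\mathcal{D}_\mu$ is sub-Gaussian (for some $K$, $X\sim\mathcal{D}_\mu$ satisfies $\mathbb{P}(|X|>x)\le 2\exp(-x^2/K^2)$ for all $x\ge0$), and that, with $C(\mu,b,h,q)=\mathbb{E}_{d\sim\mathcal{D}_\mu}[b(d-q)^++h(q-d)^+]$ and $x^+=\max\{0,x\}$, there is $\ell\in\mathbb{R}^+$ such that $|C(\mu_1,b,h,q)-C(\mu_2,b,h,q)|\le\ell|\mu_1-\mu_2|$ for all $\mu_1,\mu_2\in[\mu_{\min},\mu_{\max}]$, $b\in[0,b_{\max}]$, $h\in[0,h_{\max}]$, $q\in Q$. Write $C_t(\mu,q)=C(\mu,b_t,h_t,q)$. In each period $t$ the decision-maker selects $q_t\in Q$; then the demand $d_t$ is drawn from an unknown distribution $D_t=\mathcal{D}_{\mu_t}\in\mathcal{D}$, independently over time, and is observed. A policy is a sequence of mappings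 $\pi=(\pi_1,\dots,\pi_T)$, where $\pi_t$ maps $d_1,\dots,d_{t-1}$ to an order quantity $q_t\in Q$ ($\pi_1$ is constant). The demand variation of $\bm\mu=(\mu_1,\dots,\mu_T)$ is $V_{\bm\mu}=\max\sum_{k=1}^K|\mu_{t_k}-\mu_{t_{k-1}}|^2$, the maximum being over $0\le K\le T-1$ and all $1\le t_0<\dots<t_K\le T$. For the variation parameter $v\in[0,1]$, $\mathcal{D}(v)=\{(D_1,\dots,D_T):D_t\in\mathcal{D}\text{ for all }t\text{ and }V_{\bm\mu}\le T^v\}$. With $q_t^*\in\arg\min_{q\in Q}C_t(\mu_t,q)$, the worst-case regret of $\pi$ is $$\mathcal{R}^\pi(T)=\sup_{\bm D\in\mathcal{D}(v)}\mathbb{E}^\pi_{\bm D}\Big[\sum_{t=1}^T\big(C_t(\mu_t,q_t)-C_t(\mu_t,q_t^* )\big)\Big],$$ the expectation being over the realized demands. *)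

(* Defs.v *)
From HB Require Import structures.
From mathcomp Require Export all_boot all_order all_algebra.
From mathcomp Require Export all_classical all_reals all_analysis.
Export Order.TTheory GRing.Theory Num.Theory.
Export numFieldNormedType.Exports.

Set Implicit Arguments.
Unset Strict Implicit.
Unset Printing Implicit Defensive.

Local Open Scope classical_set_scope.
Local Open Scope ring_scope.

Section product_probability.
Variable R : realType.
Local Notation mR := (measurableTypeR R).

Definition cons_pair n (x : mR * n.-tuple mR) : n.+1.-tuple mR :=
  [the n.+1.-tuple mR of x.1 :: x.2].

Lemma measurable_cons_pair n : measurable_fun setT (@cons_pair n).
Proof. exact: (measurable_cons measurable_fst measurable_snd). Qed.

HB.instance Definition _ n :=
  isMeasurableFun.Build _ _ _ _ (@cons_pair n) (@measurable_cons_pair n).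

Fixpoint product_prob (n : nat) :
    ('I_n -> probability mR R) -> probability (n.-tuple mR) R :=
  match n with
  | 0 => fun=> \d_[tuple]
  | m.+1 => fun P : 'I_m.+1 -> probability mR R => distribution
      (P ord0 \x product_prob (fun i => P (lift ord0 i)))%E (@cons_pair m)
  end.

(* Under [product_prob P] the coordinates are independent, the i-th one having
   law [P i]. *)
Lemma product_prob_box n (P : 'I_n -> probability mR R) (A : 'I_n -> set mR) :
  (forall i, measurable (A i)) ->
  product_prob P [set x | forall i, A i (tnth x i)] = (\prod_(i < n) P i (A i))%E.
Proof.
elim: n P A => [|n IH] P A mA.
  rewrite big_ord0 /= diracE mem_set // => -[].
  by case.
rewrite big_ord_recl -IH; last by move=> i; exact: mA.
rewrite /= /distribution /pushforward.
rewrite -product_measure1E //; last first.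
  rewrite (_ : mkset _ = \bigcap_(i in setT) ((@tnth n mR)^~ i @^-1` A (lift ord0 i))).
    apply: fin_bigcap_measurable => // i _.
    rewrite -[X in measurable X]setTI; exact: measurable_tnth.
  by apply/seteqP; split=> x /= h i; [move=> _; exact: h|exact: (h i I)].
congr (_ _); apply/seteqP; split=> -[a x] /=.
  move=> h; split; first exact: (h ord0).
  by move=> i; have := h (lift ord0 i); rewrite tnthS.
move=> [h0 h] i; case: (unliftP ord0 i) => [j|] -> //.
by rewrite tnthS.
Qed.

End product_probability.

(* Periods are numbered from 0; an instance lists costs for infinitely many
   periods and a horizon T uses the first T of them. *)
Record newsvendor (R : realType) := Newsvendor {
  orders : set R;
  order_max : R;
  underage : nat -> R;
  underage_max : R;
  overage : nat -> R;
  overage_max : R;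
  mean_min : R;
  mean_max : R;
  demand : R -> probability (measurableTypeR R) R
    (* only the values on [mean_min, mean_max] matter *)
}.

Section newsvendor.
Variables (R : realType) (I : newsvendor R).

Definition means : set R := [set mu | mean_min I <= mu <= mean_max I].

(* The integrand is integrable for every instance satisfying
   [standing_assumptions], so [fine] loses nothing there. *)
Definition expected_cost (mu b h q : R) : R :=
  fine ('E_(demand I mu)
    [fun d : R => (b * Num.max 0 (d - q) + h * Num.max 0 (q - d))%R])%E.

Definition period_cost (t : nat) (mu q : R) : R :=
  expected_cost mu (underage I t) (overage I t) q.

Definition optimal_orders (t : nat) (mu : R) : set R :=
  [set q | orders I q /\
     forall q', orders I q' -> period_cost t mu q <= period_cost t mu q'].

Definition sub_gaussian (K : R) (P : probability (measurableTypeR R) R) : Prop :=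
  forall x : R, 0 <= x ->
    (P [set y : R | (x < `|y|)%R] <= (2 * expR (- (x ^+ 2 / K ^+ 2)))%:E)%E.

Record standing_assumptions : Prop := {
  orders_bounded : forall q, orders I q -> 0 <= q <= order_max I;
  underage_bounded : forall t, 0 <= underage I t <= underage_max I;
  overage_bounded : forall t, 0 <= overage I t <= overage_max I;
  means_nonempty : mean_min I <= mean_max I;
  demand_mean : forall mu, means mu ->
    ('E_(demand I mu)[fun d : R => d])%E = mu%:E;
  demand_sub_gaussian : exists K : R, 0 < K /\
    forall mu, means mu -> sub_gaussian K (demand I mu);
  cost_lipschitz : exists l : R, 0 <= l /\
    forall mu1 mu2 b h q : R, means mu1 -> means mu2 ->
      0 <= b <= underage_max I -> 0 <= h <= overage_max I -> orders I q ->
      `|expected_cost mu1 b h q - expected_cost mu2 b h q| <= l * `|mu1 - mu2|;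
  optimal_order_exists : forall t mu, means mu -> optimal_orders t mu !=set0
}.

(* Any minimizer gives the same regret, so an arbitrary one is chosen. *)
Definition optimal_order (t : nat) (mu : R) : R := xget 0 (optimal_orders t mu).

Variable T : nat.

Record policy := Policy {
  order_at : forall t : 'I_T, t.-tuple (measurableTypeR R) -> R;
  order_atP : forall (t : 'I_T) d, orders I (@order_at t d);
  measurable_order_at : forall t : 'I_T, measurable_fun setT (@order_at t)
}.

Definition history (d : T.-tuple (measurableTypeR R)) (t : 'I_T) :
    t.-tuple (measurableTypeR R) :=
  [tuple tnth d (widen_ord (ltnW (ltn_ord t)) i) | i < t].

Definition variation (mu : 'I_T -> R) : R :=
  \big[Num.max/0]_(K < T)
    \big[Num.max/0]_(s : {ffun 'I_K.+1 -> 'I_T}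
        | [forall i : 'I_K.+1, forall j : 'I_K.+1, (i < j)%N ==> (s i < s j)%N])
      \sum_(k < K)
        `|mu (s (lift ord0 k)) - mu (s (widen_ord (leqnSn K) k))| ^+ 2.

(* The set D(v), each sequence of distributions being given by its means. *)
Definition uncertainty_set (v : R) : set ('I_T -> R) :=
  [set mu | (forall t, means (mu t)) /\ variation mu <= T%:R `^ v].

Definition expected_regret (pi : policy) (mu : 'I_T -> R) : \bar R :=
  ('E_(product_prob (fun t => demand I (mu t)))
    [fun d => (\sum_(t < T)
       (period_cost t (mu t) (order_at pi (history d t))
        - period_cost t (mu t) (optimal_order t (mu t))))%R])%E.

Definition worst_case_regret (v : R) (pi : policy) : \bar R :=
  ereal_sup [set expected_regret pi mu | mu in uncertainty_set v].

End newsvendor.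

(* Main.v *)
From HB Require Import structures.
Require Import Defs.
From mathcomp Require Import measurable_realfun ring lra.

Set Implicit Arguments.
Unset Strict Implicit.
Unset Printing Implicit Defensive.

Local Open Scope ring_scope.

(** The hard instance has Bernoulli demand with mean mu in [0, 1], orders 0 and
1, and unit costs.  Ordering 0 costs mu and ordering 1 costs 1 - mu, so the
right order only depends on the side of 1/2 on which mu lies, and the wrong one
loses |2 mu - 1|.

Cut the horizon into blocks of length L and let the mean be 1/2 + delta or
1/2 - delta throughout each block, the signs of the blocks being free.  If
delta^2 <= 1 / (16 L), the demands of a whole block do not reveal its sign: any
guess of the sign, even one made with hindsight from all T demands, is wrong
with probability at least 1/6 when the sign is a fair coin ([two_point_testing],
averaged over the signs as in Assouad's lemma in [block_sign_assouad]).  Some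
choice of signs therefore makes any policy lose at least
T * 2 delta / 6 = T delta / 3.

The mean changes at most T / L times, by at most 2 delta, so the variation is
at most 4 delta^2 T / L ([variation_block_means]).  With x = T^((1 - v) / 4),
L = floor (x^2) and delta = 1 / (4 x), this is at most T / (2 x^4) = T^v / 2,
while the regret is at least T / (12 x) = T^((3 + v) / 4) / 12.

Only finitely many demand sequences have positive probability.  The regret is
nonnegative, so its expectation is at least the finite sum over these atoms
([finite_regret_le_expected_regret]), and the statistical argument is a
statement about finite sums. *)

(** * Testing between two Bernoulli products *)

Lemma bernoulli_inequality (R : realDomainType) (a : R) n :
  0 <= a <= 1 -> 1 - n%:R * a <= (1 - a) ^+ n.
Proof.
move=> /andP[a0 a1]; elim: n => [|n IH]; first by rewrite mul0r subr0.
rewrite exprS.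
have h : (1 - a) * (1 - n%:R * a) <= (1 - a) * (1 - a) ^+ n.
  by rewrite ler_wpM2l// subr_ge0.
apply: le_trans h; rewrite -natr1.
have : 0 <= n%:R * (a * a) by rewrite !mulr_ge0.
by nra.
Qed.

Section bernoulli_product.
Variables (R : realFieldType) (I : finType).
Implicit Types (m : I -> R) (x : {ffun I -> bool}).

Definition bernoulli_mass m x : R := \prod_i (if x i then m i else 1 - m i).

Lemma sum_prod_ffun (F : I -> bool -> R) :
  \sum_(x : {ffun I -> bool}) \prod_i F i (x i) =
  \prod_i (F i true + F i false).
Proof.
rewrite -(bigA_distr_bigA F) /=; apply: eq_bigr => i _.
by rewrite big_bool.
Qed.

Lemma sum_bernoulli_mass m : \sum_x bernoulli_mass m x = 1.
Proof.
rewrite (sum_prod_ffun (fun i b => if b then m i else 1 - m i)) /=.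
by apply: big1 => i _; rewrite addrC subrK.
Qed.

Lemma bernoulli_mass_ge0 m x :
  (forall i, 0 <= m i <= 1) -> 0 <= bernoulli_mass m x.
Proof.
move=> m01; apply: prodr_ge0 => i _.
by case/andP: (m01 i) => m0 m1; case: (x i) => //; rewrite subr_ge0.
Qed.

(** Let w be the mass charged to the test at x and o the other one, so that
w + o = m + m'.  If g^2 <= w * o then g <= w + o / 4 by the inequality of
arithmetic and geometric means; summing over x, the error W satisfies
sum g <= W + (2 - W) / 4.  It remains to find such a g with sum at least 3/4.
The geometric mean of the two masses would do; replacing its factor
sqrt (1/4 - e^2) on B by the smaller 1/2 - 2 e^2 avoids square roots, and the
sum of g is then (1 - 4 e^2)^|B|, at least 3/4 by Bernoulli's inequality. *)
Lemma two_point_testing m m' (B : {set I}) (e : R)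
    (test : pred {ffun I -> bool}) :
  (forall i, 0 <= m i <= 1) -> (forall i, 0 <= m' i <= 1) ->
  {in [predC B], m =1 m'} ->
  {in B, forall i, m i = 1 / 2 + e /\ m' i = 1 / 2 - e} ->
  16 * #|B|%:R * e ^+ 2 <= 1 ->
  1 / 3 <= \sum_x (if test x then bernoulli_mass m x else bernoulli_mass m' x).
Proof.
move=> m01 m'01 mE mB small.
have [B0|B_gt0] := posnP #|B|.
  rewrite (eq_bigr (bernoulli_mass m)).
    by rewrite sum_bernoulli_mass; lra.
  move=> x _; case: ifP => // _; apply: eq_bigr => i _.
  by rewrite mE// inE (card0_eq B0).
have e2 : 16 * e ^+ 2 <= 1.
  apply: le_trans small; rewrite -mulrA ler_pM2l// ler_peMl ?sqr_ge0//.
  by rewrite ler1n.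
have e20 := sqr_ge0 e.
pose w x := if test x then bernoulli_mass m x else bernoulli_mass m' x.
pose g x := \prod_i (if i \in B then 1 / 2 - 2 * e ^+ 2
                     else if x i then m i else 1 - m i).
have g0 x : 0 <= g x.
  apply: prodr_ge0 => i _; case: ifP => _; first lra.
  by case/andP: (m01 i) => ? ?; case: (x i); lra.
have gg x : g x ^+ 2 <= bernoulli_mass m x * bernoulli_mass m' x.
  rewrite expr2 -!big_split/=; apply: ler_prod => i _.
  case: ifPn => [iB|iB].
    have [-> ->] := mB _ iB; apply/andP; split; first by apply: mulr_ge0; lra.
    have : e ^+ 2 * e ^+ 2 <= 1 / 16 * e ^+ 2 by rewrite ler_wpM2r//; lra.
    by case: (x i); nra.
  rewrite -mE// lexx andbT -expr2; exact: sqr_ge0.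
have gw x : g x <= w x + (bernoulli_mass m x + bernoulli_mass m' x - w x) / 4.
  have p0 := bernoulli_mass_ge0 x m01; have q0 := bernoulli_mass_ge0 x m'01.
  rewrite -(@ler_pXn2r _ 2)//; last 2 first.
  - by rewrite nnegrE.
  - by rewrite nnegrE /w; case: ifP => _; lra.
  apply: le_trans (gg x) _; rewrite /w; case: ifP => _.
    by have := sqr_ge0 (bernoulli_mass m x - bernoulli_mass m' x / 4); nra.
  by have := sqr_ge0 (bernoulli_mass m' x - bernoulli_mass m x / 4); nra.
have G : 3 / 4 <= \sum_x g x.
  rewrite (sum_prod_ffun (fun i b => if i \in B then 1 / 2 - 2 * e ^+ 2
                            else if b then m i else 1 - m i)).
  rewrite (bigID (mem B))/= [X in _ <= _ * X]big1 ?mulr1; last first.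
    by move=> i /negPf ->; rewrite addrC subrK.
  rewrite (eq_bigr (fun=> 1 - 4 * e ^+ 2)); last by move=> i ->; lra.
  rewrite prodr_const.
  have a01 : 0 <= 4 * e ^+ 2 <= 1 by lra.
  by apply: (le_trans _ (bernoulli_inequality #|B| a01)); lra.
have : \sum_x g x <= \sum_x w x + (\sum_x bernoulli_mass m x
    + \sum_x bernoulli_mass m' x - \sum_x w x) / 4.
  rewrite -big_split/= -sumrB mulr_suml -big_split/=.
  by apply: ler_sum => x _; exact: gw.
rewrite !sum_bernoulli_mass -/w; lra.
Qed.

End bernoulli_product.

(** * Averaging over the signs of the blocks *)

Section assouad.
Variables (R : realFieldType) (I J : finType) (blk : I -> J) (delta : R).
Hypothesis delta_bounds : 0 <= delta <= 1 / 2.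

Definition block_means (eps : {ffun J -> bool}) (i : I) : R :=
  1 / 2 + (if eps (blk i) then delta else - delta).

Lemma block_means_bounds eps i : 0 <= block_means eps i <= 1.
Proof.
case/andP: delta_bounds => d0 d1.
by apply/andP; rewrite /block_means; case: ifP => _; split; lra.
Qed.

Definition flip_block (j : J) (eps : {ffun J -> bool}) : {ffun J -> bool} :=
  [ffun k => (k == j) (+) eps k].

Lemma flip_blockK j : involutive (flip_block j).
Proof. by move=> eps; apply/ffunP => k; rewrite !ffunE addKb. Qed.

(** Pair every sign pattern with the one in which the block of i is flipped.
The two product laws differ on that block only, where they are too close to be
told apart, so the errors at i under the two patterns add up to at least 1/3.
Hence the average error at i over all patterns is at least 1/6, and some pattern
reaches the average of the total error. *)
Lemma block_sign_assouad (guess : I -> {ffun I -> bool} -> bool) :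
  (forall j, 16 * #|[set i | blk i == j]%SET|%:R * delta ^+ 2 <= 1) ->
  exists eps, #|I|%:R / 6 <= \sum_x bernoulli_mass (block_means eps) x *
     \sum_i (guess i x != eps (blk i))%:R.
Proof.
move=> small.
pose W i eps : R := \sum_x bernoulli_mass (block_means eps) x *
   (guess i x != eps (blk i))%:R.
have Wflip i eps : 1 / 3 <= W i eps + W i (flip_block (blk i) eps).
  rewrite /W -big_split/=.
  set eps' := flip_block _ _.
  have eps'E : eps' (blk i) = ~~ eps (blk i) by rewrite ffunE eqxx.
  have key x :
      bernoulli_mass (block_means eps) x * (guess i x != eps (blk i))%:R +
      bernoulli_mass (block_means eps') x * (guess i x != eps' (blk i))%:R =
      if guess i x != eps (blk i) then bernoulli_mass (block_means eps) x
      else bernoulli_mass (block_means eps') x.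
    rewrite eps'E; case: (guess i x) (eps (blk i)) => [] [] /=;
      by rewrite !(mulr0, mulr1) ?addr0 ?add0r.
  rewrite (eq_bigr _ (fun x _ => key x)).
  apply: (@two_point_testing _ _ _ _ [set k | blk k == blk i]%SET
    (if eps (blk i) then delta else - delta)).
  - exact: block_means_bounds.
  - exact: block_means_bounds.
  - by move=> k; rewrite !inE /block_means ffunE => /negPf ->.
  - move=> k; rewrite inE /block_means ffunE => /eqP ->; rewrite eqxx/=.
    by split=> //; case: (eps (blk i)) => //=; rewrite opprK.
  - by case: (eps (blk i)); rewrite ?sqrrN; exact: small.
have Wsum i : #|{ffun J -> bool}|%:R / 6 <= \sum_eps W i eps.
  have : \sum_(eps : {ffun J -> bool}) (1 / 3 : R) <=
         \sum_eps (W i eps + W i (flip_block (blk i) eps)).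
    by apply: ler_sum => eps _; exact: Wflip.
  have flip_inj := inv_inj (flip_blockK (blk i)).
  rewrite big_split/= -(reindex_inj (P := predT) (F := W i) flip_inj)/=.
  rewrite sumr_const -[X in X <= _]mulr_natl; lra.
apply: contrapT => /forallNP none.
have : \sum_(eps : {ffun J -> bool}) \sum_i W i eps <
    \sum_(eps : {ffun J -> bool}) (#|I|%:R / 6).
  apply: ltr_sum => [|eps _].
    by apply/hasP; exists [ffun=> true].
  have /negP := none eps; rewrite -ltNge; apply: le_lt_trans.
  rewrite exchange_big/=; apply: ler_sum => x _; rewrite mulr_sumr.
  exact: lexx.
rewrite exchange_big/= ltNge => /negP; apply.
have -> : \sum_(eps : {ffun J -> bool}) (#|I|%:R / 6 : R) =
    \sum_(i : I) #|{ffun J -> bool}|%:R / 6.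
  by rewrite !sumr_const -[LHS]mulr_natr -[RHS]mulr_natr; ring.
by apply: ler_sum => i _; exact: Wsum.
Qed.

End assouad.

(** * Bernoulli demand and its products *)

(** A nonnegative function dominates its restriction to the points p i, and the
integral of that restriction is the sum on the left. *)
Lemma sum_atoms_le_integral d (T : measurableType d) (R : realType)
    (mu : {measure set T -> \bar R}) (I : finType) (p : I -> T) (f : T -> R) :
  injective p -> (forall i, measurable [set p i]%classic) ->
  (forall y, 0 <= f y) -> measurable_fun setT f ->
  (\sum_i (f (p i))%:E * mu [set p i]%classic <= \int[mu]_y (f y)%:E)%E.
Proof.
move=> p_inj mp f0 mf.
have mI i : measurable_fun setT (EFin \o (\1_[set p i]%classic : T -> R)).
  by apply/measurable_EFinP; exact: measurable_indic.
have E i : ((f (p i))%:E * mu [set p i]%classic =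
    \int[mu]_y ((f (p i))%:E * (\1_[set p i]%classic y)%:E))%E.
  by rewrite ge0_integralZl_EFin ?integral_indic ?setIT//; exact: mI.
rewrite (eq_bigr _ (fun i _ => E i)) -ge0_integral_sum//; last 2 first.
- by move=> i; exact: (measurable_funeM _ (mI i)).
- by move=> i y _; rewrite -EFinM lee_fin mulr_ge0.
apply: ge0_le_integral => //.
- by move=> y _; apply: sume_ge0 => i _; rewrite -EFinM lee_fin mulr_ge0.
- by apply: emeasurable_sum => i; exact: (measurable_funeM _ (mI i)).
- exact/measurable_EFinP.
move=> y _; rewrite sumEFin lee_fin.
have [[i <-]|none] := pselect (exists i, p i = y).
  rewrite (bigD1 i)//= big1 ?addr0.
    by rewrite indicE mem_set// mulr1.
  move=> j ji; rewrite indicE memNset ?mulr0// => /p_inj /esym ij.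
  by rewrite ij eqxx in ji.
rewrite big1// => i _; rewrite indicE memNset ?mulr0// => /esym piy.
by apply: none; exists i.
Qed.

Section bernoulli_demand.
Variable R : realType.
Local Notation mR := (measurableTypeR R).
Local Open Scope classical_set_scope.
Local Open Scope ring_scope.

Definition real_of_bool (b : bool) : mR := b%:R.

Lemma measurable_real_of_bool : measurable_fun setT real_of_bool.
Proof. by []. Qed.

HB.instance Definition _ :=
  isMeasurableFun.Build _ _ _ _ real_of_bool measurable_real_of_bool.

Definition bernoulli_demand (p : R) : probability mR R :=
  distribution (bernoulli_prob p) real_of_bool.

Lemma bernoulli_demand_atom (p : R) (b : bool) : 0 <= p <= 1 ->
  bernoulli_demand p [set b%:R] = (if b then p else 1 - p)%:E.
Proof.
move=> p01; rewrite /bernoulli_demand /= /distribution /pushforward.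
rewrite bernoulli_probE// !diracE.
have E (c : bool) : (c \in real_of_bool @^-1` [set (b%:R : R)]) = (c == b).
  apply/idP/idP => [/set_mem/= /eqP|/eqP ->]; last exact: mem_set.
  by rewrite /real_of_bool eqr_nat; case: b c => [] [].
by rewrite !E {E}; case: b => /=; rewrite ?mule1 ?mule0 ?adde0 ?add0e.
Qed.

(** Nonnegativity is only asked on the two atoms, so that the lemma applies to
the identity and gives the mean. *)
Lemma expectation_bernoulli_demand (p : R) (f : mR -> R) : 0 <= p <= 1 ->
  measurable_fun setT f -> (forall b : bool, 0 <= f b%:R) ->
  ('E_(bernoulli_demand p)[f] = (p * f 1 + (1 - p) * f 0)%:E)%E.
Proof.
move=> p01 mf f0.
have iE : (\int[bernoulli_prob p]_b (f (real_of_bool b))%:E =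
    (p * f 1 + (1 - p) * f 0)%:E)%E.
  by rewrite integral_bernoulli_prob// => b; rewrite lee_fin; exact: f0.
rewrite unlock integral_distribution//=.
  exact/measurable_EFinP.
apply/integrableP; split; first by [].
rewrite (eq_integral (fun b => (f (real_of_bool b))%:E)) ?iE ?ltry//.
by move=> b _ /=; rewrite ger0_norm//; exact: f0.
Qed.

Lemma product_bernoulli_atom n (m : 'I_n -> R) (x : {ffun 'I_n -> bool}) :
  (forall i, 0 <= m i <= 1) ->
  product_prob (fun i => bernoulli_demand (m i))
    [set [tuple (x i)%:R : mR | i < n]] = (bernoulli_mass m x)%:E.
Proof.
move=> m01.
have -> : [set [tuple (x i)%:R : mR | i < n]] =
    [set y : n.-tuple mR | forall i, [set (x i)%:R] (tnth y i)].
  apply/seteqP; split=> y /=; first by move=> -> i; rewrite tnth_mktuple.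
  by move=> h; apply: eq_from_tnth => i; rewrite tnth_mktuple.
rewrite (@product_prob_box _ _ _ (fun i => [set ((x i)%:R : mR)]))//.
rewrite (eq_bigr _ (fun i _ => bernoulli_demand_atom _ (m01 i))).
by rewrite prodEFin.
Qed.

Lemma measurable_set1_tuple n (y : n.-tuple mR) : measurable [set y].
Proof.
have -> : [set y] =
    \bigcap_(i in [set: 'I_n]) ((@tnth n mR)^~ i @^-1` [set tnth y i]).
  apply/seteqP; split=> z /=; first by move=> ->.
  by move=> h; apply: eq_from_tnth => i; exact: (h i).
apply: fin_bigcap_measurable => // i _.
by rewrite -[X in measurable X]setTI; apply: measurable_tnth.
Qed.

End bernoulli_demand.

(** * The Bernoulli newsvendor *)

Section instance.

Local Open Scope classical_set_scope.
Local Open Scope ring_scope.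

Variable R : realType.
Local Notation mR := (measurableTypeR R).

Definition bernoulli_newsvendor : newsvendor R := {|
  orders := [set q | q = 0 \/ q = 1];
  order_max := 1;
  underage := fun=> 1;
  underage_max := 1;
  overage := fun=> 1;
  overage_max := 1;
  mean_min := 0;
  mean_max := 1;
  demand := @bernoulli_demand R
|}.
Local Notation I := bernoulli_newsvendor.

Lemma expected_cost_bernoulli (p b h q : R) : 0 <= p <= 1 -> 0 <= b -> 0 <= h ->
  orders I q -> expected_cost I p b h q = p * (b * (1 - q)) + (1 - p) * (h * q).
Proof.
move=> p01 b0 h0 Iq; rewrite /expected_cost /=.
rewrite expectation_bernoulli_demand//=; last 2 first.
- apply: measurable_funD; apply: measurable_funM => //;
    apply: measurable_maxr => //; exact: measurable_funB.
- by move=> c; rewrite addr_ge0// mulr_ge0// le_max lexx.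
by case: Iq => ->; rewrite ?subr0 ?sub0r ?subrr ?maxxx
  ?(max_r ler01) ?(max_l (lerN10 R)); ring.
Qed.

Lemma period_cost_bernoulli t (p q : R) : 0 <= p <= 1 -> orders I q ->
  period_cost I t p q = p * (1 - q) + (1 - p) * q.
Proof.
by move=> p01 Iq; rewrite /period_cost expected_cost_bernoulli// !mul1r.
Qed.

(** Demand is at most 1, so the tail vanishes from 1 on; below 1 the bound
2 exp (- x^2 / 4) is at least 2 (1 - 1/4), which exceeds 1. *)
Lemma bernoulli_demand_sub_gaussian (p : R) :
  sub_gaussian 2 (bernoulli_demand p).
Proof.
move=> x x0; have [x1|x1] := leP 1 x.
  rewrite [leLHS](_ : _ = 0%E).
    by rewrite lee_fin mulr_ge0// expR_ge0.
  rewrite /bernoulli_demand /= /distribution /pushforward.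
  rewrite (_ : _ @^-1` _ = set0) ?measure0//.
  apply/seteqP; split=> // b /=; rewrite /real_of_bool normr_nat ltNge.
  by rewrite (le_trans _ x1)//; case: b.
apply: le_trans (probability_le1 _ _) _.
  have -> : [set y | x < `|y|] = (Num.norm : R -> R) @^-1` [set` `]x, +oo[].
    by apply/seteqP; split=> y /=; rewrite in_itv/= andbT.
  rewrite -[X in measurable X]setTI; exact: normr_measurable.
rewrite lee_fin.
have /= := expR_ge1Dx (- (x ^+ 2 / 2 ^+ 2)); nra.
Qed.

Lemma bernoulli_newsvendor_standing : standing_assumptions I.
Proof.
split => /=.
- by move=> q [] ->; rewrite ?lexx ?ler01.
- by move=> _; rewrite lexx ler01.
- by move=> _; rewrite lexx ler01.
- exact: ler01.
- move=> mu mu01; rewrite expectation_bernoulli_demand//.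
  by rewrite mulr1 mulr0 addr0.
- exists 2; split=> // mu _; exact: bernoulli_demand_sub_gaussian.
- exists 1; split=> // p1 p2 b h q p1P p2P /andP[b0 b1] /andP[h0 h1] Iq.
  rewrite !expected_cost_bernoulli// mul1r.
  have -> : p1 * (b * (1 - q)) + (1 - p1) * (h * q)
     - (p2 * (b * (1 - q)) + (1 - p2) * (h * q)) =
     (b * (1 - q) - h * q) * (p1 - p2) by ring.
  rewrite normrM ler_piMl//.
  by case: Iq => ->; rewrite ler_norml; apply/andP; split; lra.
- move=> t mu mu01; exists (if mu <= 1 / 2 then 0 else 1).
  have Io : orders I (if mu <= 1 / 2 then 0 else 1 : R).
    by case: ifP => _; [left|right].
  split=> // q Iq; rewrite !period_cost_bernoulli//.
  by have [mu2|mu2] := leP mu (1 / 2); case: Iq => ->; lra.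
Qed.

Definition regret (t : nat) (p q : R) : R :=
  period_cost I t p q - period_cost I t p (optimal_order I t p).

Lemma optimal_orderP t p :
  0 <= p <= 1 -> optimal_orders I t p (optimal_order I t p).
Proof.
move=> p01; apply: xgetPex.
exact: (optimal_order_exists bernoulli_newsvendor_standing).
Qed.

Lemma regret_ge0 t p q : 0 <= p <= 1 -> orders I q -> 0 <= regret t p q.
Proof.
by move=> p01 Iq; rewrite subr_ge0; case: (optimal_orderP t p01) => _; exact.
Qed.

(** Here s is the side of 1/2 on which the mean lies, and also the optimal
order. *)
Lemma wrong_side_regret t (s : bool) (delta q : R) : 0 <= delta <= 1 / 2 ->
  orders I q ->
  2 * delta * ((q == 1) != s)%:R <=
    regret t (1 / 2 + (if s then delta else - delta)) q.
Proof.
set p := 1 / 2 + _ => /andP[d0 d1] Iq.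
have p01 : 0 <= p <= 1 by apply/andP; rewrite /p; case: (s); split; lra.
have [E|_] := boolP (_ != s); last by rewrite mulr0; exact: regret_ge0.
have Is : orders I (s%:R) by case: (s); [right|left].
rewrite mulr1 /regret.
have := (optimal_orderP t p01).2 _ Is.
rewrite (period_cost_bernoulli _ p01 Is) (period_cost_bernoulli _ p01 Iq).
move: E; rewrite /p; case: Iq => ->; case: (s);
  rewrite ?eqxx ?(eq_sym 0) ?oner_eq0//= => _; lra.
Qed.

(** The integrand is nonnegative, so discarding everything outside the atoms of
the product law can only decrease the expectation.  Measurability rests on the
cost being affine in the order on {0, 1}. *)
Lemma finite_regret_le_expected_regret (T : nat) (pi : policy I T)
    (mu : 'I_T -> R) : (forall t, 0 <= mu t <= 1) ->
  ((\sum_x bernoulli_mass mu x *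
     \sum_(t < T) regret t (mu t)
       (order_at pi (history [tuple (x i)%:R : mR | i < T] t)))%:E
   <= expected_regret pi mu)%E.
Proof.
move=> mu01; rewrite /expected_regret expectation.unlock.
pose f (d : T.-tuple mR) :=
  \sum_(t < T) regret t (mu t) (order_at pi (history d t)).
have f0 d : 0 <= f d.
  by apply: sumr_ge0 => t _; apply: regret_ge0 => //; exact: order_atP.
have mf : measurable_fun setT f.
  apply: measurable_sum => t.
  have mh : measurable_fun setT (fun d : T.-tuple mR => history d t).
    apply/measurable_fun_tnthP => i.
    apply: (eq_measurable_fun
      (fun d : T.-tuple mR => tnth d (widen_ord (ltnW (ltn_ord t)) i))).
      by move=> d _ /=; rewrite tnth_mktuple.
    exact: measurable_tnth.
  have mq :
      measurable_fun setT (fun d : T.-tuple mR => order_at pi (history d t)).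
    exact: (measurableT_comp (@measurable_order_at _ _ _ pi t) mh).
  apply: (eq_measurable_fun (fun d =>
     mu t * (1 - order_at pi (history d t))
     + (1 - mu t) * order_at pi (history d t)
     - period_cost I t (mu t) (optimal_order I t (mu t)))).
    move=> d _; rewrite /regret.
    by rewrite (period_cost_bernoulli t (mu01 t) (order_atP pi (history d t))).
  apply: measurable_funB => //; apply: measurable_funD;
    apply: measurable_funM => //; exact: measurable_funB.
pose pt (x : {ffun 'I_T -> bool}) : T.-tuple mR := [tuple (x i)%:R | i < T].
have pt_inj : injective pt.
  move=> x y xy; apply/ffunP => i; have := congr1 (fun z => tnth z i) xy.
  rewrite !tnth_mktuple => /eqP; rewrite eqr_nat.
  by case: (x i) (y i) => [] [].
have := @sum_atoms_le_integral _ _ _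
  (product_prob (fun t => demand I (mu t))) _ pt f pt_inj
  (fun x => measurable_set1_tuple (pt x)) f0 mf.
apply: le_trans; rewrite -sumEFin; apply: lee_sum => x _.
rewrite [X in (_ <= _ * X)%E](product_bernoulli_atom x mu01).
by rewrite -EFinM mulrC.
Qed.

End instance.

(** * Means that are constant on blocks of consecutive periods *)

Section blocks.
Variables (R : realType) (T L : nat).
Hypothesis L_gt0 : (0 < L)%N.

(** Blocks are indexed by periods too: t %/ L is at most t, so it is a valid
index, and the number of blocks need not be named. *)
Definition block (t : 'I_T) : 'I_T :=
  Ordinal (leq_ltn_trans (leq_div t L) (ltn_ord t)).

Lemma card_block j : (#|[set t | block t == j]%SET| <= L)%N.
Proof.
rewrite -[leqRHS]card_ord.
apply: (@leq_card_in _ _ (fun t : 'I_T => Ordinal (ltn_pmod t L_gt0))).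
move=> s t; rewrite !inE => /eqP <- /eqP/(congr1 val) /= blk.
move=> /(congr1 val) /= md.
by apply: val_inj; rewrite /= (divn_eq s L) (divn_eq t L) blk md.
Qed.

(** Along increasing periods the block number is nondecreasing, and it grows by
at least 1 whenever the mean changes.  Each squared jump is thus at most
(2 delta)^2 times the increase of the block number, and these increases
telescope to at most T / L. *)
Lemma variation_block_means (delta : R) (eps : {ffun 'I_T -> bool}) :
  variation (block_means block delta eps) <= (2 * delta) ^+ 2 * (T%:R / L%:R).
Proof.
have bound_ge0 : 0 <= (2 * delta) ^+ 2 * (T%:R / L%:R).
  by rewrite mulr_ge0 ?sqr_ge0// divr_ge0.
apply: bigmax_le => // K _; apply: bigmax_le => // s /forallP s_incr.
pose b (j : nat) : nat := (s (inord j) %/ L)%N.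
have b_homo k : (k < K)%N -> (b k <= b k.+1)%N.
  move=> kK; apply: leq_div2r; apply: ltnW.
  have /forallP/(_ (inord k.+1))/implyP := s_incr (inord k); apply.
  by rewrite !inordK// ltnS ltnW.
have step (k : 'I_K) : `|block_means block delta eps (s (lift ord0 k))
    - block_means block delta eps (s (widen_ord (leqnSn K) k))| ^+ 2
    <= (2 * delta) ^+ 2 * ((b k.+1)%:R - (b k)%:R).
  have -> : lift ord0 k = inord k.+1.
    by apply: val_inj; rewrite /= inordK// ltnS.
  have -> : widen_ord (leqnSn K) k = inord k.
    by apply: val_inj; rewrite /= inordK// ltnS ltnW.
  rewrite real_normK ?num_real//.
  have := b_homo k (ltn_ord k); rewrite leq_eqVlt => /predU1P[bE|blt].
    have blkE : block (s (inord k)) = block (s (inord k.+1)).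
      by apply: val_inj; exact: bE.
    by rewrite /block_means blkE bE !subrr expr0n mulr0.
  have jump : 1 <= (b k.+1)%:R - (b k)%:R :> R.
    by rewrite lerBrDr addrC natr1 ler_nat.
  apply: (@le_trans _ _ ((2 * delta) ^+ 2)).
    by have := sqr_ge0 delta; rewrite /block_means; do 2 case: ifP => _; nra.
  by rewrite ler_peMr// sqr_ge0.
apply: le_trans (ler_sum _ (fun k _ => step k)) _.
rewrite -mulr_sumr ler_wpM2l ?sqr_ge0//.
rewrite -(big_mkord predT (fun k => (b k.+1)%:R - (b k)%:R)) telescope_sumr//.
rewrite ler_pdivlMr ?ltr0n//.
apply: (@le_trans _ _ ((b K)%:R * L%:R)); first by rewrite ler_wpM2r// gerBl.
rewrite -natrM ler_nat (leq_trans (leq_trunc_div _ _))//.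
exact/ltnW/ltn_ord.
Qed.

End blocks.

(** * The lower bound *)

Theorem proposition1 (R : realType) :
  exists c : R, 0 < c /\
  exists I : newsvendor R, standing_assumptions I /\
  forall (T : nat) (v : R) (pi : policy I T),
    (0 < T)%N -> 0 <= v <= 1 ->
    ((c * T%:R `^ ((3 + v) / 4))%:E <= worst_case_regret v pi)%E.
Proof.
exists (1 / 12); split; first by lra.
exists (bernoulli_newsvendor R).
split; first exact: bernoulli_newsvendor_standing.
move=> T v pi T_gt0 /andP[v0 v1].
have T0 : 0 < T%:R :> R by rewrite ltr0n.
have T1 : 1 <= T%:R :> R by rewrite ler1n.
pose x : R := T%:R `^ ((1 - v) / 4).
have x1 : 1 <= x by rewrite -(powRr0 T%:R) ler_powR//; lra.
(* x is chosen so that these two identities hold: the first calibrates the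
   variation, the second the regret. *)
have Tv : T%:R `^ v * x ^+ 4 = T%:R.
  rewrite -powR_mulrn ?powR_ge0// -powRrM -powRD ?(gt_eqF T0) ?implybT//.
  have -> : v + (1 - v) / 4 * 4%:R = 1 by lra.
  by rewrite powRr1// ltW.
have Tr : T%:R `^ ((3 + v) / 4) * x = T%:R.
  rewrite -powRD ?(gt_eqF T0) ?implybT//.
  have -> : (3 + v) / 4 + (1 - v) / 4 = 1 by lra.
  by rewrite powRr1// ltW.
have x2_ge1 : 1 <= x ^+ 2 by rewrite exprn_ege1.
pose L := Num.truncn (x ^+ 2).
have /andP[Lx xL] := truncn_itv (le_trans ler01 x2_ge1).
have L_gt0 : (0 < L)%N by rewrite truncn_gt0.
have L1 : 1 <= L%:R :> R by rewrite ler1n.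
pose delta := 1 / (4 * x).
have delta_x : delta * x = 1 / 4 by rewrite /delta; field; lra.
have delta_x2 : delta ^+ 2 * x ^+ 2 = 1 / 16 by rewrite -exprMn delta_x; lra.
have delta_bounds : 0 <= delta <= 1 / 2.
  have d0 : 0 <= delta by rewrite /delta divr_ge0//; lra.
  by apply/andP; split => //; nra.
have d2 := sqr_ge0 delta.
have [|eps eps_bad] := @block_sign_assouad R 'I_T 'I_T (block L) delta
    delta_bounds
    (fun t y => order_at pi (history [tuple (y i)%:R | i < T] t) == 1).
  move=> j; have := card_block L_gt0 j; rewrite -(ler_nat R) => cL.
  have := ler_wpM2r d2 (le_trans cL Lx).
  by rewrite [X in _ <= X]mulrC delta_x2; lra.
set mu := block_means (block L) delta eps.
have mu01 t : 0 <= mu t <= 1 by exact: block_means_bounds.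
apply: (@le_trans _ _ (expected_regret pi mu)); last first.
  apply: ereal_sup_ubound; exists mu => //; split; first exact: mu01.
  apply: le_trans (variation_block_means L_gt0 delta eps) _.
  rewrite mulrA ler_pdivrMr ?ltr0n// exprMn -{1}Tv.
  have -> : 2 ^+ 2 * delta ^+ 2 * (T%:R `^ v * x ^+ 4) =
      4 * (delta ^+ 2 * x ^+ 2) * (T%:R `^ v * x ^+ 2) by ring.
  rewrite delta_x2.
  have -> : 4 * (1 / 16) * (T%:R `^ v * x ^+ 2) = T%:R `^ v * (x ^+ 2 / 4).
    by field.
  rewrite ler_wpM2l ?powR_ge0//.
  (* x ^+ 2 < L + 1 <= 2 * L, since L >= 1 *)
  by move: xL; rewrite -natr1 -/L; lra.
apply: le_trans (finite_regret_le_expected_regret pi mu01).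
rewrite lee_fin.
apply: (@le_trans _ _ (2 * delta * (#|'I_T|%:R / 6))).
  have -> : 1 / 12 * T%:R `^ ((3 + v) / 4) =
      T%:R `^ ((3 + v) / 4) * (1 / 4) / 3 by lra.
  rewrite -delta_x card_ord -{2}Tr; lra.
have delta2 : 0 <= 2 * delta by case/andP: delta_bounds => ? ?; lra.
apply: le_trans (ler_wpM2l delta2 eps_bad) _.
rewrite mulr_sumr; apply: ler_sum => y _.
rewrite mulrCA ler_wpM2l ?bernoulli_mass_ge0// mulr_sumr.
apply: ler_sum => t _; apply: wrong_side_regret => //; exact: order_atP.
Qed.
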